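(* Let $n\ge 2$. Every $\pi\in M_{2n,\binom{2n-1}{2}}$ is a cyclic shift of $[2\ 4\ 6\ \cdots\ 2n-2\ 1\ 3\ 5\ \cdots\ 2n-1]$, i.e. there is $a\in\mathbb Z_{2n-1}$ with $\pi(x)=\sigma(x-a)$ for all $x\in\mathbb Z_{2n-1}$, where $\sigma=[2\ 4\ \cdots\ 2n-2\ 1\ 3\ \cdots\ 2n-1]$.
   Context: Permutations in $S_N$ are bijections of $\mathbb Z_N$ written $[\pi(1)\ \cdots\ \pi(N)]$. Pointers: entry $k$ has left pointer $(k-1,k)$ and right pointer $(k,k+1)$; the pointer word $W(\pi)$ lists $L(\pi(1))R(\pi(1))\cdots L(\pi(N))R(\pi(N))$ with $(0,1)$ and $(N,N+1)$ removed. Two distinct pointers form a valid pointer context if their occurrences in $W(\pi)$ interleave ($p\ldots q\ldots p\ldots q$ or $q\ldots p\ldots q\ldots p$). Strategic pile: with $X_N=(0\ 1\ \cdots\ N)$, $Y_\pi=(\pi(N)\ \cdots\ \pi(1)\ 0)$ in cycle notation and $C_\pi=Y_\pi\circ X_N$, $\mathrm{SP}(\pi)$ is the set of numbers after $N$ and before $0$ in the cycle of $C_\pi$ containing $0$ and $N$ (empty if different cycles). $\pi\in S_{2n}$ has maximal strategic pile if $|\mathrm{SP}(\pi)|=2n-1$; then $2n$ is immediately followed by $1$, and its contraction is the element of $S_{2n-1}$ obtained by deleting the entry $2n$. $M_{2n,k}$ is the set of contractions of permutations in $S_{2n}$ with maximal strategic pile and exactly $k$ valid pointer contexts. *)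

(* Defs.v *)
From mathcomp Require Import all_boot all_order all_fingroup all_algebra.
Set Implicit Arguments.
Unset Strict Implicit.
Unset Printing Implicit Defensive.
Import GRing.Theory.

(* S_N is {perm 'Z_N}, which is the intended type for 1 < N. As in one-line
   notation, Z_N is represented by 1, ..., N, so that 0 : 'Z_N stands for N. *)
Definition repr1 (N : nat) (x : 'Z_N) : nat :=
  if x == 0%R then N else nat_of_ord x.

Definition oneline (N : nat) (pi : {perm 'Z_N}) : seq nat :=
  [seq repr1 (pi k%:R%R) | k <- iota 1 N].

Definition of_oneline (N : nat) (w : seq nat) (x : 'Z_N) : 'Z_N :=
  ((nth 0 w (repr1 x).-1)%:R)%R.

Definition pointer : Type := (nat * nat)%type.
Definition left_pointer (k : nat) : pointer := (k.-1, k).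
Definition right_pointer (k : nat) : pointer := (k, k.+1).

Definition pointer_word (N : nat) (pi : {perm 'Z_N}) : seq pointer :=
  [seq p <- flatten [seq [:: left_pointer k; right_pointer k]
                      | k <- oneline pi]
   | (p != (0, 1)) && (p != (N, N.+1))].

Definition valid_context (N : nat) (pi : {perm 'Z_N}) (p q : pointer) : bool :=
  [&& p != q &
      subseq [:: p; q; p; q] (pointer_word pi)
      || subseq [:: q; p; q; p] (pointer_word pi)].

(* An unordered pair {(i, i+1), (j, j+1)} of distinct pointers is counted once,
   through the pair of indices i < j. *)
Definition num_valid_contexts (N : nat) (pi : {perm 'Z_N}) : nat :=
  #|[set ij : 'I_N.+1 * 'I_N.+1
      | (ij.1 < ij.2) &&
        valid_context pi (right_pointer ij.1) (right_pointer ij.2)]|.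

(* next c is the cyclic permutation written c in cycle notation. *)
Definition X_cycle (N : nat) : 'I_N.+1 -> 'I_N.+1 := next (enum 'I_N.+1).

Definition Y_cycle (N : nat) (pi : {perm 'Z_N}) : 'I_N.+1 -> 'I_N.+1 :=
  next (rcons [seq inord k | k <- rev (oneline pi)] ord0).

Definition C_perm (N : nat) (pi : {perm 'Z_N}) : 'I_N.+1 -> 'I_N.+1 :=
  Y_cycle pi \o @X_cycle N.

(* arc c N 0 starts at N and stops just before 0; behead drops N itself. *)
Definition strategic_pile (N : nat) (pi : {perm 'Z_N}) : {set 'I_N.+1} :=
  let c := fingraph.orbit (C_perm pi) ord_max in
  if ord0 \in c then [set x in behead (arc c ord_max ord0)] else set0.

Definition max_strategic_pile (n : nat) (pi : {perm 'Z_(2 * n)}) : bool :=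
  #|strategic_pile pi| == 2 * n - 1.

Definition is_contraction (n : nat) (pi : {perm 'Z_(2 * n)})
    (tau : {perm 'Z_(2 * n - 1)}) : bool :=
  oneline tau == [seq k <- oneline pi | k != 2 * n].

Definition M (n k : nat) : {set {perm 'Z_(2 * n - 1)}} :=
  [set tau | [exists pi : {perm 'Z_(2 * n)},
     [&& max_strategic_pile pi, num_valid_contexts pi == k
       & is_contraction pi tau]]].

(* [2 4 ... 2n-2 1 3 ... 2n-1] *)
Definition sigma_word (n : nat) : seq nat :=
  [seq 2 * i | i <- iota 1 n.-1] ++ [seq (2 * i).+1 | i <- iota 0 n].

Definition sigma (n : nat) : 'Z_(2 * n - 1) -> 'Z_(2 * n - 1) :=
  @of_oneline (2 * n - 1) (sigma_word n).
Arguments sigma : clear implicits.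

(* Main.v *)
Require Import Defs.
From mathcomp Require Import all_boot all_order all_fingroup all_algebra.
From mathcomp Require Import zify.

Set Implicit Arguments.
Unset Strict Implicit.
Unset Printing Implicit Defensive.
Import GRing.Theory.

(* Put N = 2n and m = N - 1. A maximal strategic pile forces C 0 = N, that is, N
   is immediately followed by 1, so after contraction the pointer word reads
   (v_1 - 1) v_1 (v_2 - 1) v_2 ... with entries taken in Z_m. Having 'C(m, 2)
   valid contexts means that every two of the m pointers interleave; then each
   other letter occurs exactly once between the two occurrences of a given one,
   which are thus at distance m. As m is odd, this compares a right pointer with
   a left one and gives pi (x + n) = pi x + 1. Since n + n = 1 in Z_m, it
   follows that pi x = pi 0 + 2 x, whereas sigma x = 2 x. *)

(** * Interleaving letters in a word *)

(** Deleting all letters except [x] and [y] leaves a word of length 4. The alternating subsequence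
    also has length 4, so it is that whole word, and both alternating patterns have a single [y]
    between the two [x]. *)
Lemma count_between_occurrences (T : eqType) (W A B C : seq T) (x y : T) :
  W = A ++ x :: B ++ x :: C -> x != y ->
  count_mem x W = 2 -> count_mem y W = 2 ->
  subseq [:: x; y; x; y] W || subseq [:: y; x; y; x] W ->
  count_mem y B = 1.
Proof.
move=> defW xy cx cy sW.
have filter_only_y S : count_mem x S = 0 ->
    filter (pred2 x y) S = nseq (count_mem y S) y.
  elim: S => //= z S IH; case: eqP => //= _ /IH ->.
  by case: eqP => //= ->.
have count2 S : count (pred2 x y) S = count_mem x S + count_mem y S.
  elim: S => //= z S ->; rewrite -[RHS]addnACA; congr (_ + _).
  by case: eqP => // ->; rewrite (negbTE xy).
have szD : size (filter (pred2 x y) W) = 4 by rewrite size_filter count2 cx cy.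
have D_of_subseq S : size S = 4 -> all (pred2 x y) S -> subseq S W ->
    filter (pred2 x y) W = S.
  move=> szS aS sS; apply/esym/eqP.
  have sD : subseq S (filter (pred2 x y) W) by rewrite subseq_filter aS.
  by rewrite -(size_subseq_leqif sD) szS szD.
have defD : (filter (pred2 x y) W == [:: x; y; x; y])
    || (filter (pred2 x y) W == [:: y; x; y; x]).
  by case/orP: sW => /D_of_subseq ->; rewrite //= ?eqxx ?orbT.
move: cx cy; rewrite defW !count_cat /=.
rewrite !count_cat /= !eqxx (negbTE xy) => cx cy.
move: defD; rewrite defW filter_cat /= eqxx filter_cat /= eqxx /=.
rewrite !filter_only_y; try lia.
have yx : (y == x) = false by rewrite eq_sym (negbTE xy).
move: cy; case: (count_mem y A) => [|[|[|a]]]; case: (count_mem y B) => [|[|[|b]]];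
  case: (count_mem y C) => [|[|[|c]]] => //=; try lia;
  by rewrite !eqseq_cons ?eqxx ?yx ?(negbTE xy) /= ?andbF.
Qed.

(** Two occurrences of a letter enclose every other letter of [P] once, hence lie exactly [size P]
    apart; a letter in the first half of [W] can only be repeated to its right. *)
Lemma all_interleave_square (T : eqType) (P W : seq T) (x0 : T) (i : nat) :
  uniq P -> (forall x, count_mem x W = 2 * (x \in P)) ->
  (forall x y, x \in P -> y \in P -> x != y ->
     subseq [:: x; y; x; y] W || subseq [:: y; x; y; x] W) ->
  i < size P -> nth x0 W (i + size P) = nth x0 W i.
Proof.
move=> P_uniq cW cross iP.
have inP x : x \in W -> x \in P.
  by rewrite -has_pred1 has_count cW; case: (x \in P).
(* Every other letter occurs exactly once between the two occurrences of x. *)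
have gap x A B C : W = A ++ x :: B ++ x :: C -> (size B).+1 = size P.
  move=> defW; have xP : x \in P.
    by apply: inP; rewrite defW mem_cat in_cons eqxx orbT.
  have cB y : count_mem y B = (y \in P) && (y != x).
    case: (eqVneq y x) => [->|yx]; rewrite ?andbF ?andbT.
      have := cW x; rewrite defW xP !count_cat /= count_cat /= eqxx; lia.
    case yP: (y \in P); last first.
      have := cW y; rewrite defW yP !count_cat /= count_cat /=; lia.
    apply: (count_between_occurrences defW); rewrite ?cW ?xP ?yP //.
      by rewrite eq_sym.
    by apply: cross; rewrite // eq_sym.
  have memB y : (y \in B) = (y \in P) && (y != x).
    by rewrite -has_pred1 has_count cB; case: (_ && _).
  have B_uniq : uniq B by apply: count_mem_uniq => y; rewrite cB memB.
  rewrite -[LHS]/(size (x :: B)); apply/perm_size/uniq_perm => [||y] //=.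
    by rewrite memB eqxx andbF.
  by rewrite in_cons memB; case: (eqVneq y x) => [->|_]; rewrite ?andbT ?xP.
(* [W] is a rearrangement of [P ++ P]. *)
have szW : size W = size P + size P.
  rewrite -size_cat; apply: perm_size; apply/allP => x _ /=.
  by rewrite cW count_cat (count_uniq_mem _ P_uniq) mul2n addnn.
have iW : i < size W by rewrite szW; lia.
have := cat_take_drop i W; rewrite (drop_nth x0 iW).
set x := nth x0 W i; set A := take i W; set D := drop i.+1 W => defW.
have szA : size A = i by rewrite size_takel // ltnW.
have xW : x \in W by rewrite mem_nth.
have xAD : (x \in A) || (x \in D).
  have := cW x; rewrite (inP _ xW) -defW count_cat /= eqxx => cx.
  by rewrite -!has_pred1 !has_count; lia.
(* An earlier occurrence of [x] would force [size P <= i]. *)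
case/orP: xAD => [/path.splitPr xA|/path.splitPr xD].
  case: xA defW szA => A1 A2; rewrite -catA /= => /esym/gap.
  by rewrite size_cat /=; lia.
case: xD defW => B C /esym defW; have szB := gap _ _ _ _ defW.
rewrite {1}defW nth_cat szA ltnNge leq_addr /= addKn -szB /=.
by rewrite nth_cat ltnn subnn.
Qed.

(** * Representatives from 1 to [N] and one-line words *)

Lemma natr_repr1 (N : nat) (x : 'Z_N) : 1 < N -> ((repr1 x)%:R = x)%R.
Proof.
move=> N1; rewrite /repr1; case: eqP => [->|_]; last exact: natr_Zp.
by rewrite pchar_Zp.
Qed.

Lemma repr1_bounds (N : nat) (x : 'Z_N) : 1 < N -> 0 < repr1 x <= N.
Proof.
move=> N1; rewrite /repr1; case: eqP => [_|x0]; first by rewrite leqnn ltnW.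
have xN : x < N by rewrite -[X in _ < X](Zp_cast N1) ltn_ord.
rewrite (ltnW xN) andbT lt0n; apply/eqP => x0'; apply: x0.
exact: val_inj.
Qed.

Lemma oneline_size (N : nat) (pi : {perm 'Z_N}) : size (oneline pi) = N.
Proof. by rewrite size_map size_iota. Qed.

Lemma natr_Zp_eq (N i j : nat) : 1 < N ->
  (i%:R == j%:R :> 'Z_N)%R = (i == j %[mod N]).
Proof. by move=> N1; rewrite -val_eqE /= !val_Zp_nat. Qed.

Lemma natr_Zp_inj (N i j : nat) : 1 < N -> 0 < i <= N -> 0 < j <= N ->
  (i%:R = j%:R :> 'Z_N)%R -> i = j.
Proof.
move=> N1 iN jN /eqP; rewrite natr_Zp_eq // => /eqP.
have mE k : 0 < k <= N -> k %% N = if k == N then 0 else k.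
  by case: eqP => [->|kN] kb; [rewrite modnn | rewrite modn_small //; lia].
by rewrite !mE //; case: eqP; case: eqP; lia.
Qed.

Lemma oneline_uniq (N : nat) (pi : {perm 'Z_N}) : 1 < N -> uniq (oneline pi).
Proof.
move=> N1; rewrite map_inj_in_uniq ?iota_uniq // => i j.
rewrite !mem_iota => ib jb /(congr1 (fun k => k%:R%R : 'Z_N)).
rewrite !natr_repr1 // => /perm_inj; apply: natr_Zp_inj => //; lia.
Qed.

Lemma oneline_perm (N : nat) (pi : {perm 'Z_N}) :
  1 < N -> perm_eq (oneline pi) (iota 1 N).
Proof.
move=> N1; apply: uniq_perm; rewrite ?oneline_uniq ?iota_uniq //.
apply: (uniq_min_size (oneline_uniq pi N1) _ _).2 => [k /mapP[j _ ->]|].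
  by have := repr1_bounds (pi j%:R%R) N1; rewrite mem_iota; lia.
by rewrite oneline_size size_iota.
Qed.

(** * The strategic pile and the adjacency of [N] and 1 *)

Lemma Y_word_uniq (N : nat) (pi : {perm 'Z_N}) : 1 < N ->
  uniq (rcons [seq inord k | k <- rev (oneline pi)] (@ord0 N)).
Proof.
move=> N1; rewrite rcons_uniq map_inj_in_uniq ?rev_uniq ?oneline_uniq ?andbT //.
  apply/mapP => -[k]; rewrite mem_rev (perm_mem (oneline_perm pi N1)) mem_iota.
  by move=> kb /(congr1 val); rewrite /= inordK; lia.
move=> i j; rewrite !mem_rev !(perm_mem (oneline_perm pi N1)) !mem_iota.
by move=> ib jb /(congr1 val); rewrite /= !inordK; lia.
Qed.

Lemma C_perm_inj (N : nat) (pi : {perm 'Z_N}) : 1 < N -> injective (C_perm pi).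
Proof.
move=> N1; apply: inj_comp; apply: can_inj (prev_next _).
  exact: Y_word_uniq.
exact: enum_uniq.
Qed.

(** The pile together with 0 and [N] exhausts all [N.+1] points. So the orbit of [N] is everything,
    0 comes last in it, and one more step returns to [N]. *)
Lemma C_perm_ord0 (N : nat) (pi : {perm 'Z_N}) : 1 < N ->
  #|strategic_pile pi| = N.-1 -> C_perm pi ord0 = ord_max.
Proof.
move=> N1; rewrite /strategic_pile; set f := C_perm pi.
have f_inj : injective f by exact: C_perm_inj.
set c := fingraph.orbit f ord_max.
case: ifP => c0; last by rewrite cards0; lia.
have c_size : size c = fingraph.order f ord_max by rewrite size_orbit.
have order_le : fingraph.order f ord_max <= N.+1.
  by rewrite -[X in _ <= X]card_ord max_card.
have i0 : index ord0 c < size c by rewrite index_mem.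
have arcE : arc c ord_max ord0 = take (index ord0 c) c.
  have c_head : index ord_max c = 0.
    by rewrite /c /fingraph.orbit -orderSpred /= eqxx.
  by rewrite /arc c_head rot0.
rewrite cardsE => cE.
(* With its head [N] dropped, the arc has one element fewer than the index of 0, so that index is at
   least [N]; the orbit has at most [N.+1] elements. *)
have := card_size (behead (arc c ord_max ord0)); rewrite cE arcE size_behead.
rewrite size_take i0 => ile.
have iN : index ord0 c = N by lia.
have oN : fingraph.order f ord_max = N.+1 by lia.
have E : nth ord_max c N = iter N f ord_max by apply: nth_traject; rewrite oN.
have := nth_index ord_max c0; rewrite iN E => <-.
by have := iter_order f_inj ord_max; rewrite oN.
Qed.

Lemma X_cycle0 (N : nat) : 0 < N -> X_cycle (@ord0 N) = inord 1.
Proof.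
move=> N0; rewrite /X_cycle next_nth mem_enum /=.
have /= i0 := index_enum_ord (@ord0 N); rewrite i0.
have := size_enum_ord N.+1; case e: (enum 'I_N.+1) => [|y s] //= _.
have -> : nth y s 0 = nth y (enum 'I_N.+1) 1 by rewrite e.
by apply: val_inj; rewrite /= nth_enum_ord ?inordK.
Qed.

Lemma next_mid (T : eqType) (s t : seq T) (x y : T) :
  uniq (s ++ x :: y :: t) -> next (s ++ x :: y :: t) x = y.
Proof.
move=> us; rewrite next_nth mem_cat mem_head orbT.
have ix : index x (s ++ x :: y :: t) = size s.
  move: us; rewrite cat_uniq /= negb_or => /and3P[_ /andP[xs _] _].
  by rewrite index_cat (negbTE xs) /= eqxx addn0.
rewrite ix; case: s {us ix} => //= z s.
by rewrite -cat_rcons nth_cat size_rcons ltnn subnn.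
Qed.

(** Since [X_cycle] sends 0 to 1, [C_perm pi ord0 = ord_max] says that [Y_cycle] sends 1 to [N]. As
    [Y_cycle] reads the word backwards, [N] precedes 1 in it. *)
Lemma max_pile_adjacent (N : nat) (pi : {perm 'Z_N}) : 1 < N ->
  #|strategic_pile pi| = N.-1 ->
  exists s t, oneline pi = s ++ N :: 1 :: t.
Proof.
move=> N1 /(C_perm_ord0 N1); rewrite /C_perm /= X_cycle0 ?(ltnW N1) //.
have pw := oneline_perm pi N1; have uw := Y_word_uniq pi N1.
have w1 : 1 \in oneline pi by rewrite (perm_mem pw) mem_iota; lia.
rewrite /Y_cycle; case/path.splitPr defw : _ / w1 => [s t]; rewrite defw in pw uw *.
move: uw; rewrite rev_cat rev_cons cat_rcons map_cat rcons_cat /=.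
case: (lastP s) defw pw => [|s' k] defw pw.
  (* If 1 opened the word, its successor in [Y_cycle] would be 0 instead of [N]. *)
  move=> uw; rewrite next_mid //= => /(congr1 val) /=; lia.
rewrite rev_rcons /= => uw; rewrite next_mid // => /(congr1 val) /=.
have kw : k \in iota 1 N.
  by rewrite -(perm_mem pw) mem_cat mem_rcons mem_head.
move: kw; rewrite mem_iota => kb; rewrite inordK; last lia.
by move=> ->; exists s', t; rewrite cat_rcons.
Qed.

(** * Valid contexts and the contracted pointer word *)

(** Only the [N.-1] inner pointers can occur in a context, so the assumed count is the largest
    possible and every pair must contribute. *)
Lemma all_contexts_valid (N : nat) (pi : {perm 'Z_N}) (i j : nat) : 1 < N ->
  num_valid_contexts pi = 'C(N.-1, 2) -> 0 < i < j -> j < N ->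
  valid_context pi (right_pointer i) (right_pointer j).
Proof.
move=> N1; rewrite /num_valid_contexts; set V := [set _ | _] => cV ij jN.
pose B : {set 'I_N.+1} := ~: [set ord0; ord_max].
pose Q := [set p : 'I_N.+1 * 'I_N.+1 | [&& p.1 < p.2, p.1 \in B & p.2 \in B]].
have cB : #|B| = N.-1.
  have := cardsC [set ord0; @ord_max N]; rewrite cards2 card_ord -/B.
  rewrite -val_eqE /=; case: eqP => [|_ [E]]; first lia.
  by apply: etrans (congr1 predn E).
have cQ : #|Q| <= 'C(N.-1, 2).
  (* An increasing pair is determined by its underlying two-element subset of [B]. *)
  rewrite -cB -cards_draws -(card_in_imset (f := fun p => [set p.1; p.2])).
    apply/subset_leq_card/subsetP => _ /imsetP[p + ->].
    rewrite !inE => /and3P[p12 p1 p2]; rewrite cards2 neq_ltn p12 andbT.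
    by apply/subsetP => z; rewrite !inE => /orP[] /eqP ->.
  move=> [a b] [c d]; rewrite !inE /= => /andP[ab _] /andP[cd _] /setP E.
  have := E a; have := E b; rewrite !inE !eqxx orbT /=.
  move=> /esym/orP[] /eqP eb /esym/orP[] /eqP ea; subst; move: ab cd => //; lia.
have ptr_inner (k : 'I_N.+1) : right_pointer k \in pointer_word pi -> k \in B.
  rewrite mem_filter !inE /right_pointer !xpair_eqE -!val_eqE /= => /andP[+ _].
  by lia.
have VQ : V \subset Q.
  apply/subsetP => p; rewrite inE => /andP[p12 /andP[_ H]]; rewrite inE p12 /=.
  by case/orP: H => /mem_subseq H;
    apply/andP; split; apply: ptr_inner; apply: H; rewrite !inE eqxx ?orbT.
have /eqP VE : V == Q by rewrite eqEcard VQ cV.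
have : (inord i, inord j) \in V.
  rewrite VE !inE /= -!val_eqE /= !inordK; lia.
by rewrite inE /= !inordK; [case/andP|lia|lia].
Qed.

Lemma nth_flatten_pairs (f : nat -> nat) (v : seq nat) (i : nat) : i < size v ->
  nth 0 (flatten [seq [:: f k; k] | k <- v]) (2 * i) = f (nth 0 v i) /\
  nth 0 (flatten [seq [:: f k; k] | k <- v]) (2 * i).+1 = nth 0 v i.
Proof.
elim: v i => [|k v IH] [|i] //.
by rewrite ltnS mulnS add2n => /IH.
Qed.

Lemma count_flatten_pairs (f : nat -> nat) (v : seq nat) (x : nat) :
  count_mem x (flatten [seq [:: f k; k] | k <- v]) =
  count_mem x (map f v) + count_mem x v.
Proof. by elim: v => //= k v ->; lia. Qed.

Definition cyclic_pred (m k : nat) : nat := if k == 1 then m else k.-1.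

Lemma natr_cyclic_pred (m k : nat) : 1 < m -> 0 < k ->
  ((cyclic_pred m k)%:R = k%:R - 1 :> 'Z_m)%R.
Proof.
rewrite /cyclic_pred => m1; case: k => // k _; rewrite eqSS -natr1 addrK.
by case: eqP => [->|_] //; rewrite pchar_Zp.
Qed.

(** Supplies the left-pointer half of the count: each letter occurs once as a left pointer and once
    as a right one. *)
Lemma cyclic_pred_perm (m : nat) (v : seq nat) : perm_eq v (iota 1 m) ->
  perm_eq (map (cyclic_pred m) v) (iota 1 m).
Proof.
move=> pv; have mv k : k \in v -> 0 < k <= m.
  by rewrite (perm_mem pv) mem_iota; lia.
have uv : uniq (map (cyclic_pred m) v).
  rewrite map_inj_in_uniq ?(perm_uniq pv) ?iota_uniq // => i j /mv + /mv.
  by rewrite /cyclic_pred; do 2 case: eqP; lia.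
apply: uniq_perm; rewrite ?iota_uniq //.
apply: (uniq_min_size uv _ _).2 => [k /mapP[j /mv jb ->]|].
  by rewrite mem_iota /cyclic_pred; case: eqP; lia.
by rewrite size_map (perm_size pv).
Qed.

(* The entries N and 1 each contribute a single pointer, so together they act
   as one entry 1 whose left pointer is the cyclic one. *)
Lemma pointer_word_adjacent (N : nat) (pi : {perm 'Z_N}) (s t : seq nat) :
  1 < N -> oneline pi = s ++ N :: 1 :: t ->
  map fst (pointer_word pi) =
  flatten [seq [:: cyclic_pred N.-1 k; k] | k <- s ++ 1 :: t].
Proof.
move=> N1 defw; have := oneline_uniq pi N1; have pw := oneline_perm pi N1.
have wb k : k \in oneline pi -> 0 < k <= N.
  by rewrite (perm_mem pw) mem_iota; lia.
have inner r : {subset r <= oneline pi} -> N \notin r -> 1 \notin r ->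
  map fst [seq p <- flatten [seq [:: left_pointer k; right_pointer k] | k <- r]
    | (p != (0, 1)) && (p != (N, N.+1))] =
  flatten [seq [:: cyclic_pred N.-1 k; k] | k <- r].
  elim: r => //= k r IH sub; rewrite !inE !negb_or => /andP[kN Nr] /andP[k1 r1].
  have kb : 0 < k <= N by apply: wb; apply: sub; rewrite mem_head.
  rewrite /left_pointer /right_pointer !xpair_eqE.
  have -> : ~~ ((k.-1 == 0) && (k == 1)) && ~~ ((k.-1 == N) && (k == N.+1)).
    by lia.
  have -> : ~~ ((k == 0) && (k.+1 == 1)) && ~~ ((k == N) && (k.+1 == N.+1)).
    by lia.
  rewrite /= IH // => [|z zr]; last by apply: sub; rewrite in_cons zr orbT.
  by rewrite /cyclic_pred eq_sym (negbTE k1).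
have subs : {subset s <= oneline pi} by move=> z zs; rewrite defw mem_cat zs.
have subt : {subset t <= oneline pi}.
  by move=> z zt; rewrite defw mem_cat !in_cons zt !orbT.
rewrite defw cat_uniq /= !in_cons !negb_or.
case/and3P=> _ /and3P[Ns s1 _] /and3P[/andP[_ Nt] t1 _].
rewrite /pointer_word defw !map_cat !flatten_cat filter_cat map_cat inner //=.
rewrite !xpair_eqE /=.
have -> : ~~ ((N.-1 == 0) && (N == 1)) && ~~ ((N.-1 == N) && (N == N.+1)).
  by lia.
have -> : (~~ ((N == 0) && (N.+1 == 1)) && ~~ ((N == N) && (N.+1 == N.+1))) = false.
  by lia.
have -> : ~~ ((1 == N) && (2 == N.+1)) by lia.
by rewrite /= inner.
Qed.

(** * From periodicity of the word to an affine formula *)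

(** The even entries are literally [2 * r]; in the odd half, [2 * r] exceeds the entry by exactly
    the modulus [2 * n - 1]. *)
Lemma sigma_double (n : nat) (x : 'Z_(2 * n - 1)) : 1 < n ->
  (sigma n x = x + x)%R.
Proof.
move=> n1; have m1 : 1 < 2 * n - 1 by lia.
have := repr1_bounds x m1; rewrite /sigma /of_oneline => rb.
rewrite -[in RHS](natr_repr1 x m1) -natrD.
move: (repr1 x) rb => r rb; apply/eqP; rewrite natr_Zp_eq // /sigma_word.
rewrite nth_cat size_map size_iota; case: ltnP => rn.
  rewrite (nth_map 0) ?size_iota // nth_iota //; apply/eqP; congr (_ %% _); lia.
have r'n : r.-1 - n.-1 < n by lia.
rewrite (nth_map 0) ?size_iota // nth_iota //.
have -> : r + r = (2 * (0 + (r.-1 - n.-1))).+1 + (2 * n - 1) by lia.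
by rewrite modnDr.
Qed.

Theorem theorem4p9 (n : nat) (hn : 2 <= n)
    (pi : {perm 'Z_(2 * n - 1)})
    (hpi : pi \in M n 'C(2 * n - 1, 2)) :
  exists a : 'Z_(2 * n - 1),
    forall x : 'Z_(2 * n - 1), pi x = sigma n (x - a)%R.
Proof.
move: hpi; rewrite inE => /existsP[rho /and3P[/eqP hSP /eqP hV /eqP defpi]].
have N1 : 1 < 2 * n by lia.
have m1 : 1 < 2 * n - 1 by lia.
have mE : (2 * n).-1 = 2 * n - 1 by lia.
rewrite -mE in hSP hV.
have [s [t defrho]] := max_pile_adjacent N1 hSP.
have := oneline_uniq rho N1.
rewrite defrho cat_uniq /= !in_cons !negb_or => /and3P[_ /and3P[Ns _ _]].
case/and3P=> /andP[N1' Nt] _ _.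
have noN r : 2 * n \notin r -> [seq k <- r | k != 2 * n] = r.
  by move=> Nr; apply/all_filterP/allP => k kr; apply: contraNneq Nr => <-.
have {}defpi : oneline pi = s ++ 1 :: t.
  by rewrite defpi defrho filter_cat /= eqxx /= eq_sym N1' !noN.
have W := pointer_word_adjacent N1 defrho; rewrite -defpi mE in W.
set v := oneline pi in defpi W.
have pv : perm_eq v (iota 1 (2 * n - 1)) by exact: oneline_perm.
have szv : size v = 2 * n - 1 by rewrite oneline_size.
set U := flatten _ in W.
have sq i : i < 2 * n - 1 -> nth 0 U (i + (2 * n - 1)) = nth 0 U i.
  move=> im; rewrite -{1}(size_iota 1 (2 * n - 1)).
  apply: all_interleave_square; rewrite ?iota_uniq ?size_iota //.
    move=> x; rewrite count_flatten_pairs (seq.permP (cyclic_pred_perm pv)).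
    rewrite (seq.permP pv) count_uniq_mem ?iota_uniq //; by case: (_ \in _).
  have lt_cross x y : 0 < x < y -> y < 2 * n ->
      subseq [:: x; y; x; y] U || subseq [:: y; x; y; x] U.
    move=> xy yN; have /andP[_] := all_contexts_valid N1 hV xy yN.
    by rewrite -W => /orP[] /(map_subseq fst) /= -> //; rewrite orbT.
  move=> x y; rewrite !mem_iota neq_ltn => xb yb /orP[] xy.
    by apply: lt_cross; lia.
  by rewrite orbC; apply: lt_cross; lia.
have piE k : k < 2 * n - 1 -> pi (k.+1%:R)%R = ((nth 0 v k)%:R)%R.
  move=> km; rewrite /v /oneline (nth_map 0) ?size_iota // nth_iota //.
  by rewrite natr_repr1.
have nthU k : k < 2 * n - 1 ->
    nth 0 U (2 * k) = cyclic_pred (2 * n - 1) (nth 0 v k) /\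
    nth 0 U (2 * k).+1 = nth 0 v k.
  by move=> km; apply: nth_flatten_pairs; rewrite szv.
have v_gt0 k : k < 2 * n - 1 -> 0 < nth 0 v k.
  move=> km; have : nth 0 v k \in v by rewrite mem_nth ?szv.
  by rewrite (perm_mem pv) mem_iota; lia.
have m0 : ((2 * n - 1)%:R = 0 :> 'Z_(2 * n - 1))%R by exact: pchar_Zp.
have pi_shift (x : 'Z_(2 * n - 1)) : (pi (x + n%:R) = pi x + 1)%R.
  rewrite -(natr_repr1 x m1) -natrD; have := repr1_bounds x m1.
  (* The right pointer of entry [k] sits at [(2 * k).+1]. For [k < n.-1] this is in the first half,
     and its partner is the left pointer of entry [k + n]; otherwise its partner lies earlier, at
     entry [k - n.-1], which is [k + n] modulo [2 * n - 1]. *)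
  case: (repr1 x) => // k /= km; have [kn|nk] := ltnP k n.-1.
    rewrite addSn !piE; try lia.
    have /nthU[_ E1] : k < 2 * n - 1 by lia.
    have /nthU[E2 _] : k + n < 2 * n - 1 by lia.
    rewrite -E1 -sq; last lia.
    have -> : (2 * k).+1 + (2 * n - 1) = 2 * (k + n) by lia.
    by rewrite E2 natr_cyclic_pred ?subrK //; apply: v_gt0; lia.
  have -> : k.+1 + n = (k - n.-1).+1 + (2 * n - 1) by lia.
  rewrite natrD m0 addr0 !piE; try lia.
  have /nthU[E1 _] : k - n.-1 < 2 * n - 1 by lia.
  have /nthU[_ E2] : k < 2 * n - 1 by lia.
  rewrite -E2.
  have -> : (2 * k).+1 = 2 * (k - n.-1) + (2 * n - 1) by lia.
  rewrite sq; last lia.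
  by rewrite E1 natr_cyclic_pred ?subrK //; apply: v_gt0; lia.
have nn1 : (n%:R + n%:R = 1 :> 'Z_(2 * n - 1))%R.
  rewrite -natrD; have -> : n + n = 1 + (2 * n - 1) by lia.
  by rewrite natrD m0 addr0.
have pi_step (x : 'Z_(2 * n - 1)) : (pi (x + 1) = pi x + 1 + 1)%R.
  by rewrite -[X in (x + X)%R]nn1 addrA !pi_shift.
have pi_lin k : (pi k%:R = pi 0 + k%:R + k%:R)%R.
  elim: k => [|k IH]; first by rewrite !addr0.
  by rewrite -natr1 pi_step IH -!addrA (addrCA 1%R).
(* As [n] is the inverse of 2, doubling [x + n%:R * pi 0] gives [x + x + pi 0]. *)
exists (- (n%:R * pi 0))%R => x.
rewrite sigma_double // opprK -{1}(natr_Zp x) pi_lin natr_Zp.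
by rewrite addrACA -mulrDl nn1 mul1r addrC addrA.
Qed.
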